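(* Let $s\in(1,\infty)$. Then there exists an Ahlfors $s$-regular compact metric measure space $(X,d,\mu)$ with the following property: there exists a pair $(u,g)$ with $u,g\in L^s(X)$ satisfying a $(1,s)$-Poincaré inequality for all balls in $X$, but \[ \int_X\exp\big(c|u-u_X|^q\big)\,d\mu=\infty \] for every $q>1$ and every $c>0$.
   Context: A metric measure space $(X,d,\mu)$ is a metric space $(X,d)$ with at least two points, equipped with a Borel measure $\mu$ such that $0<\mu(B(x,r))<\infty$ for all $x\in X$, $r\in(0,\infty)$, where $B(x,r)$ is the open ball. For $B=B(z,R)$ and $\sigma\ge1$, $\sigma B=B(z,\sigma R)$. For $0<\mu(A)<\infty$, $u_A=\mu(A)^{-1}\int_A u\,d\mu$. $(X,d,\mu)$ is Ahlfors $s$-regular if there is a constant $K\ge1$ such that $K^{-1}r^s\le\mu(B(x,r))\le K r^s$ for all $x\in X$ and $0<r\le\operatorname{diam}X$. A pair $(u,g)$ with $u$ locally integrable and $g\ge0$ locally $s$-integrable satisfies a $(1,s)$-Poincaré inequality if there are parameters $\sigma\ge1$ and $C_{PI}>0$ such that \[ \frac1{\mu(B)}\int_B|u-u_B|\,d\mu\le C_{PI}\operatorname{diam}(B)\left(\frac1{\mu(\sigma B)}\int_{\sigma B}g^s\,d\mu\right)^{1/s} \] for every ball $B\subset X$. *)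

(* Defs.v *)
From HB Require Import structures.
From mathcomp Require Import all_boot all_order all_algebra.
From mathcomp Require Import all_classical all_reals all_analysis.

Set Implicit Arguments.
Unset Strict Implicit.
Unset Printing Implicit Defensive.

Import Order.TTheory GRing.Theory Num.Theory.

Local Open Scope classical_set_scope.
Local Open Scope ring_scope.

(* The library's measurable types are pointed; since a metric measure space
   has at least two points, choosing a base point is no restriction. *)
#[short(type="pmetricType")]
HB.structure Definition PointedMetric (K : numDomainType) :=
  {M of Metric K M & isPointed M}.

Notation borel X := (g_sigma_algebraType (@open X)).

Section MetricMeasureSpaces.
Context {R : realType} {X : pmetricType R}.
Variable mu : {measure set (borel X) -> \bar R}.
Implicit Types (s r : R) (z : X) (u g : borel X -> R).

Definition diam (A : set X) : \bar R :=
  ereal_sup [set (mdist p.1 p.2)%:E | p in A `*` A].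

Definition metric_measure_space : Prop :=
  (exists x y : X, x <> y) /\
  (forall z r, 0 < r -> (0 < mu (ball z r) < +oo)%E).

Definition ahlfors_regular s : Prop :=
  exists2 K : R, 1 <= K &
    forall z r, 0 < r -> (r%:E <= diam [set: X])%E ->
      ((K^-1 * r `^ s)%:E <= mu (ball z r) <= (K * r `^ s)%:E)%E.

Definition average (A : set (borel X)) (f : borel X -> \bar R) : \bar R :=
  ((mu A)^-1 * \int[mu]_(x in A) f x)%E.

(* u_A *)
Definition mean (A : set (borel X)) u : R := fine (average A (EFin \o u)).

Definition locally_integrable u : Prop :=
  measurable_fun [set: borel X] u /\
  forall z, exists2 r : R, 0 < r & mu.-integrable (ball z r) (EFin \o u).

Definition poincare_inequality s u g : Prop :=
  [/\ locally_integrable u,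
      forall x, 0 <= g x,
      measurable_fun [set: borel X] g,
      locally_integrable (fun x => g x `^ s) &
      exists sigma CPI : R, [/\ 1 <= sigma, 0 < CPI &
        forall z r, 0 < r ->
          (average (ball z r) (fun x => `|u x - mean (ball z r) u|%:E)
           <= CPI%:E * diam (ball z r) *
              average (ball z (sigma * r)) (fun x => (g x `^ s)%:E)
                `^ s^-1)%E]].

End MetricMeasureSpaces.

(* Main.v *)
(* X is the space of binary sequences with d(x, y) = 2^(-N/s), where N is the
   first index at which x and y differ, and mu is the coin tossing measure. Balls
   are cylinders, and cylinders of depth n have measure 2^-n and diameter
   2^(-n/s). The function u depends only on the position N(x) of the first 1 in
   x, namely u(x) = a_0 + ... + a_(N(x)-1) with a_n = 1/ln(n+2). It is constant
   on every cylinder not containing the zero sequence, while on the cylinder of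
   depth n around it its mean oscillation is at most 2 a_n. Choosing g as a
   function of N(x) so that g^s integrates to a_n^s on that cylinder (possible
   because a_n decreases to 0) gives the Poincare inequality with sigma = 1.
   Finally u grows like n/ln n on {N = n}, a set of measure 2^-(n+1), so that
   exp(c|u - u_X|^q) is not integrable as soon as q > 1. *)

Require Import Defs.
From HB Require Import structures.
From mathcomp Require Import all_boot all_order all_algebra.
From mathcomp Require Import all_classical all_reals all_analysis.
From mathcomp Require Import measurable_realfun.
From mathcomp Require Import ring lra zify.

Set Implicit Arguments.
Unset Strict Implicit.
Unset Printing Implicit Defensive.

Import Order.TTheory GRing.Theory Num.Theory.

Local Open Scope classical_set_scope.
Local Open Scope ring_scope.

(** * Cylinders of binary sequences *)

Definition cylinder (n : nat) (z : nat -> bool) : set (nat -> bool) :=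
  [set y | forall k, (k < n)%N -> z k = y k].

Lemma cylinder0 z : cylinder 0 z = setT.
Proof. by apply/seteqP; split. Qed.

Lemma cylinderS n z : cylinder n.+1 z = cylinder n z `&` [set y | z n = y n].
Proof.
apply/seteqP; split=> y /=.
  by move=> zy; split=> [k kn|]; apply: zy => //; exact: ltnW.
by move=> [zy zyn] k; rewrite ltnS leq_eqVlt => /orP[/eqP->|/zy].
Qed.

Lemma cylinder_eq n z y : cylinder n z y -> cylinder n z = cylinder n y.
Proof.
by move=> zy; apply/seteqP; split=> x zx k kn; rewrite ?zy// -?zx// zy.
Qed.

(* The parameter [s] only tags the type, to select the metric on it. *)
Definition binseq (R : realType) (s : {posnum R}) : Type := nat -> bool.

HB.instance Definition _ (R : realType) (s : {posnum R}) :=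
  Choice.copy (binseq s) (nat -> bool).
HB.instance Definition _ (R : realType) (s : {posnum R}) :=
  isPointed.Build (binseq s) (fun=> false).

(** * The metric given by the first differing index *)

Section metric.
Context {R : realType} (s : {posnum R}).
Implicit Types (x y z : binseq s) (m n k : nat).

(** Chosen so that its [s]-th power is 1/2, the factor by which the measure of a cylinder drops with
    each further digit. *)
Definition shrink : R := 2^-1 `^ s%:num^-1.

Lemma shrink_gt0 : 0 < shrink. Proof. by rewrite powR_gt0. Qed.

Lemma shrink_lt1 : shrink < 1.
Proof.
have -> : 1 = 1 `^ s%:num^-1 :> R by rewrite powR1.
by rewrite gt0_ltr_powR ?invr_gt0 ?nnegrE//; lra.
Qed.

Lemma shrinkX_powR n : (shrink ^+ n) `^ s%:num = 2^-1 ^+ n.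
Proof.
rewrite -!powR_mulrn ?invr_ge0 ?ltW ?shrink_gt0// /shrink -!powRrM.
by rewrite mulrCA mulVf ?mulr1.
Qed.

Lemma shrinkX_le m n : (m <= n)%N -> shrink ^+ n <= shrink ^+ m.
Proof.
by move=> mn; rewrite ler_wiXn2l// ltW// ?shrink_gt0// shrink_lt1.
Qed.

Lemma shrinkX_lt m n : (shrink ^+ n < shrink ^+ m) = (m < n)%N.
Proof. by rewrite ltr_iXn2l// ?shrink_gt0// shrink_lt1. Qed.

Definition dist x y : R :=
  if pselect (exists n, x n != y n) is left h then shrink ^+ ex_minn h else 0.

Lemma dist_ge x y n : x n != y n -> shrink ^+ n <= dist x y.
Proof.
rewrite /dist => xy; case: pselect => [h|]; last by case; exists n.
by case: ex_minnP => m _ /(_ _ xy); exact: shrinkX_le.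
Qed.

Lemma distP x y :
  x = y /\ dist x y = 0 \/ exists2 n, x n != y n & dist x y = shrink ^+ n.
Proof.
rewrite /dist; case: pselect => [h|xy].
  by case: ex_minnP => m xym _; right; exists m.
left; split=> //; apply/funext => n; apply/eqP/negPn/negP => xyn.
by apply: xy; exists n.
Qed.

Lemma dist_ge0 x y : 0 <= dist x y.
Proof.
by case: (distP x y) => [[_ ->]|[n _ ->]]//; rewrite exprn_ge0// ltW// shrink_gt0.
Qed.

Lemma distxx x : dist x x = 0.
Proof. by case: (distP x x) => [[_ ->]|[n]]//; rewrite eqxx. Qed.

Lemma dist_eq0 x y : dist x y = 0 -> x = y.
Proof.
case: (distP x y) => [[-> _]|[n _ ->]]// /eqP.
by rewrite expf_eq0 (gt_eqF shrink_gt0) andbF.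
Qed.

Lemma dist_sym x y : dist x y = dist y x.
Proof.
suff H a b : dist a b <= dist b a by apply/eqP; rewrite eq_le !H.
case: (distP a b) => [[-> _]//|[n abn ->]].
by rewrite dist_ge// eq_sym.
Qed.

(** If [x] and [z] first differ at [n], then [y] differs at [n] from one of them, so one summand
    alone is at least [shrink ^+ n]. *)
Lemma dist_triangle y x z : dist x z <= dist x y + dist y z.
Proof.
case: (distP x z) => [[-> _]|[n xzn ->]].
  by rewrite distxx addr_ge0// dist_ge0.
have [xyn|/dist_ge xyn] := eqVneq (x n) (y n).
  by rewrite ler_wpDl ?dist_ge0// dist_ge// -xyn.
by rewrite ler_wpDr ?dist_ge0.
Qed.

HB.instance Definition _ := @isMetric.Build R (binseq s) dist
  distxx dist_eq0 dist_sym dist_triangle.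

End metric.


(** * Balls, compactness and Borel sets *)

Section topology.
Context {R : realType} (s : {posnum R}).
Implicit Types (x y z : binseq s) (m n k : nat).
Local Notation X := (binseq s).
Local Notation l := (shrink s).

Lemma mdistE x y : mdist x y = dist x y. Proof. by []. Qed.

Lemma dist_le_cylinder x y n : (dist x y <= l ^+ n) <-> cylinder n x y.
Proof.
split=> [dn k kn|xy].
  apply/eqP/negPn/negP => /dist_ge/le_trans/(_ dn).
  by rewrite leNgt shrinkX_lt kn.
case: (distP x y) => [[_ ->]|[m xym ->]].
  by rewrite exprn_ge0// ltW// shrink_gt0.
by apply: shrinkX_le; rewrite leqNgt; apply/negP => /xy/eqP; rewrite (negPf xym).
Qed.

(** Nonzero distances are powers of [l], so the depth is the least [n] with [l ^+ n < r]. Minimality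
    gives the last clause; depth 0 is the case where [r] exceeds 1. *)
Lemma ball_cylinderE z (r : R) : 0 < r ->
  exists n, [/\ ball z r = cylinder n z, l ^+ n < r &
    n = 0 \/ r <= l ^+ n.-1].
Proof.
move=> r0.
have [n0 n0P] : exists n, l ^+ n < r.
  have /cvgrPdist_lt /(_ _ r0) [n _ /(_ n (leqnn n))] : l ^+ n @[n --> \oo] --> 0.
    by apply: cvg_expr; rewrite gtr0_norm ?shrink_gt0 ?shrink_lt1.
  by rewrite /= sub0r normrN => /(le_lt_trans (ler_norm _)); exists n.
have h : exists n, l ^+ n < r by exists n0.
exists (ex_minn h); case: ex_minnP => n nr nmin; split=> //.
  rewrite ballEmdist; apply/seteqP; split=> y /=; rewrite mdistE.
    move=> dr; apply/dist_le_cylinder.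
    case: (distP z y) dr => [[_ ->]|[m _ ->]].
      by rewrite exprn_ge0// ltW// shrink_gt0.
    by move=> /nmin; exact: shrinkX_le.
  by move=> /dist_le_cylinder/le_lt_trans; exact.
case: n nr nmin => [|n] _ nmin; [by left|right].
by rewrite leNgt; apply/negP => /nmin; rewrite ltnn.
Qed.

(** Balls are open, so radius [l ^+ m] excludes the points that first differ from [z] at index [m].
    At depth 0 any radius above 1 would do. *)
Lemma cylinder_ball n z : cylinder n z = ball z (if n is m.+1 then l ^+ m else 2).
Proof.
have r0 : 0 < (if n is m.+1 then l ^+ m else 2).
  by case: n => // m; rewrite exprn_gt0// shrink_gt0.
have [m [-> + +]] := ball_cylinderE z r0.
case: n {r0} => [_|n].
  case=> [->//|]; rewrite leNgt (@le_lt_trans _ _ 1)//; last lra.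
  by rewrite exprn_ile1 ?ltW ?shrink_lt1 ?shrink_gt0.
rewrite shrinkX_lt => nm [m0|]; first by rewrite m0 in nm.
rewrite leNgt shrinkX_lt -leqNgt => mn; congr cylinder; apply/eqP.
by rewrite eqn_leq nm -(ltn_predK nm) ltnS.
Qed.

Lemma nbhs_cylinder n z : nbhs z (cylinder n z : set X).
Proof.
rewrite cylinder_ball; apply: nbhsx_ballx.
by case: n => // m; rewrite exprn_gt0// shrink_gt0.
Qed.

Lemma open_cylinder n (z : X) : open (cylinder n z : set X).
Proof.
rewrite openE => y zy; rewrite /interior (cylinder_eq zy).
exact: nbhs_cylinder.
Qed.

Lemma nbhs_sub_cylinder z (U : set X) :
  nbhs z U -> exists n, (cylinder n z : set X) `<=` U.
Proof.
move=> /nbhs_ballP[r /= r0 zU]; have [n [E _ _]] := ball_cylinderE z r0.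
by exists n; rewrite -E.
Qed.

(** Compactness is carried over from the Cantor space by the identity, which is continuous because a
    cylinder is a finite intersection of conditions on single coordinates. *)
Lemma compact_binseq : compact [set: X].
Proof.
have -> : [set: X] = (id : cantor_space -> X) @` setT by rewrite image_id.
apply: continuous_compact; last exact: cantor_space_compact.
apply: continuous_subspaceT => z U /= /nbhs_sub_cylinder[n nU].
apply: filterS (nU : cylinder n z `<=` _) _.
elim: n {nU} => [|n IH]; first by apply: filterS filterT.
rewrite cylinderS; apply: filterI => //.
have : \forall y \near (z : cantor_space), proj n y = proj n z.
  apply: (@proj_continuous _ (fun=> bool) n z [set b | b = proj n z]).
  exact: discrete_set1.
by apply: filterS => y /esym.
Qed.

Lemma diam_binseq_le1 : (diam [set: X] <= 1)%E.
Proof.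
apply: ub_ereal_sup => _ /= [[x y] _ <-] /=; rewrite lee_fin mdistE.
by apply/(dist_le_cylinder _ _ 0).
Qed.

(** Flipping digit [n] of [z] stays in the cylinder. This bounds the right-hand side of the Poincaré
    inequality from below. *)
Lemma diam_cylinder_ge n z : ((l ^+ n)%:E <= diam (cylinder n z : set X))%E.
Proof.
pose y : X := fun k => if k == n then ~~ z n else z k.
apply: (@le_trans _ _ (dist z y)%:E).
  by rewrite lee_fin dist_ge// /y eqxx; case: (z n).
apply: ereal_sup_ubound; exists (z, y) => //; split=> //= k kn.
by rewrite /y ltn_eqF.
Qed.

Lemma borel_open (U : set X) : open U -> measurable (U : set (borel X)).
Proof. by move=> oU; apply: sub_gen_smallest. Qed.

Lemma measurable_cylinder n (z : X) : measurable (cylinder n z : set (borel X)).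
Proof. by apply: borel_open; exact: open_cylinder. Qed.

(** Indexing by finite words makes the union countable, so that measurability passes from cylinders
    to open sets. *)
Lemma open_bigcup_cylinder (U : set X) : open U ->
  U = \bigcup_(w in [set w : seq bool |
    cylinder (size w) (nth false w) `<=` U]) cylinder (size w) (nth false w).
Proof.
rewrite openE => oU; apply/seteqP; split=> [z Uz|z [w wU]]; last exact: wU.
have [n nU] := nbhs_sub_cylinder (oU _ Uz).
have E : cylinder n z = cylinder (size (mkseq z n)) (nth false (mkseq z n)).
  by rewrite size_mkseq; apply: cylinder_eq => k kn; rewrite nth_mkseq.
by exists (mkseq z n) => /=; rewrite -E.
Qed.

End topology.

(** * Binary digits of a real number *)

Section binary_digits.
Context {R : realType}.
Implicit Types (t : R) (n : nat) (z : nat -> bool).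

(** On [[0, 1[] this is t -> 2t mod 1, which shifts the binary expansion by one digit. *)
Definition doubling t : R := if t < 2^-1 then 2 * t else 2 * t - 1.

Definition digits t : nat -> bool := fun n => 2^-1 <= iter n doubling t.

Lemma measurable_doubling : measurable_fun [set: R] doubling.
Proof.
have m2 : measurable_fun [set: R] (fun t : R => 2 * t).
  exact: (@measurable_funM _ _ _ _ (cst 2) id).
apply: measurable_fun_if => //; first exact: measurable_fun_ltr.
by apply: measurable_funTS; exact: measurable_funB.
Qed.

Lemma measurable_digit n b : measurable [set t | b = digits t n].
Proof.
have mi : measurable_fun [set: R] (iter n doubling).
  elim: n => [|n IH]; first exact: measurable_id.
  exact: (measurableT_comp measurable_doubling IH).
have md : measurable_fun [set: R] (fun t => digits t n).
  exact: measurable_fun_ler.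
rewrite -[X in measurable X]setTI (_ : [set t | _] =
  (fun t => digits t n) @^-1` [set b]); first exact: md.
by apply/seteqP; split => t /=.
Qed.

Lemma measurable_preimage_cylinder n z :
  measurable (digits @^-1` cylinder n z : set R).
Proof.
elim: n => [|n IH].
  by rewrite cylinder0 preimage_setT.
rewrite cylinderS preimage_setI; apply: measurableI => //.
exact: measurable_digit.
Qed.

(** Induction for all [z] at once: the first digit selects a half of the unit interval, and the
    other digits are those of [doubling t], handled by the shifted sequence. *)
Lemma preimage_cylinder_itv n z : exists p : R, [/\ 0 <= p, p + 2^-1 ^+ n <= 1 &
  digits @^-1` cylinder n z `&` `[0, 1[ = `[p, p + 2^-1 ^+ n[%classic].
Proof.
elim: n z => [|n IH] z.
  exists 0; rewrite expr0 add0r; split => //.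
  by rewrite cylinder0 preimage_setT setTI.
have [p [p0 p1 E]] := IH (fun k => z k.+1).
have e0 : 0 < 2^-1 ^+ n :> R by rewrite exprn_gt0// invr_gt0.
have Et t : (forall k, (k < n)%N -> z k.+1 = digits t k) /\ 0 <= t < 1 <->
    p <= t < p + 2^-1 ^+ n.
  move/seteqP : E => [E1 E2]; split=> [[zt t01]|tp].
    by have := E1 t; rewrite /= !in_itv/=; apply.
  by have := E2 t; rewrite /= !in_itv/=; apply.
have split0 t : cylinder n.+1 z (digits t) <->
    z 0 = (2^-1 <= t) /\ forall k, (k < n)%N -> z k.+1 = digits (doubling t) k.
  split=> [zt|[z0 zt] [|k] kn].
  - by split=> [|k kn]; [exact: (zt 0)|rewrite (zt k.+1)// /digits iterSr].
  - by [].
  - by rewrite zt// /digits iterSr.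
(* These are the two inverse branches of the doubling map, applied to the left endpoint [p]. *)
exists (if z 0 then (p + 1) / 2 else p / 2); rewrite exprS.
split; [by case: (z 0); lra|by case: (z 0); lra|].
apply/seteqP; split => t /=; rewrite !in_itv/=.
  move=> [/split0[z0 zt] t01]; have := (Et (doubling t)).1; move: zt z0.
  rewrite /doubling; have [t2 zt z0|t2 zt z0] := ltP t 2^-1.
    rewrite z0 => H; suff : p <= 2 * t < p + 2^-1 ^+ n by lra.
    by apply: H; split=> //; lra.
  rewrite z0 => H; suff : p <= 2 * t - 1 < p + 2^-1 ^+ n by lra.
  by apply: H; split=> //; lra.
move=> tp; have t01 : 0 <= t < 1 by case: (z 0) tp; lra.
split=> //; apply/split0.
have [z0|z0] := boolP (z 0); rewrite ?z0 ?(negPf z0) in tp.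
  have t2 : 2^-1 <= t by lra.
  have := (Et (doubling t)).2; rewrite /doubling ltNge t2 /=.
  by move=> H; split=> //; apply H; lra.
have t2 : t < 2^-1 by lra.
have := (Et (doubling t)).2; rewrite /doubling t2 => H.
by split; [rewrite leNgt t2|apply H; lra].
Qed.

End binary_digits.

(** * The coin tossing measure *)

Section coin_measure.
Context {R : realType} (s : {posnum R}).
Local Notation X := (binseq s).

Lemma measurable_digits :
  measurable_fun [set: R] (digits : R -> borel X).
Proof.
apply: (@measurability _ _ R (borel X) setT (digits : R -> borel X) (@open X)) =>
  // _ [U oU <-].
rewrite setTI (open_bigcup_cylinder oU) preimage_bigcup bigcup_mkcond.
apply: countable_bigcupT_measurable => [|w]; first exact: countableP.
by case: ifPn => // _; exact: measurable_preimage_cylinder.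
Qed.

(** The law of the binary digits of a uniform point of [[0, 1[]; countable additivity is inherited
    from Lebesgue measure. *)
Definition coin : set (borel X) -> \bar R :=
  pushforward (mrestr lebesgue_measure (measurable_itv `[0, 1[))
    (digits : R -> borel X).

HB.instance Definition _ := Measure.copy coin
  (measure_function_pushforward__canonical__measure_function_Measure
    (mrestr lebesgue_measure (measurable_itv `[0, 1[)) measurable_digits).

Lemma coin_cylinder n z : coin (cylinder n z) = (2^-1 ^+ n)%:E.
Proof.
have [p [_ _ E]] := @preimage_cylinder_itv R n z.
rewrite /coin /pushforward /mrestr/= E lebesgue_measure_itv/= lte_fin ltrDl.
by rewrite exprn_gt0 ?invr_gt0// -EFinB addrAC subrr add0r.
Qed.

End coin_measure.

(** * Position of the first 1 and its level sets *)

Section first_one.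
Implicit Types (x y z : nat -> bool) (k n m : nat).

Definition zeros : nat -> bool := fun=> false.

(* [first_one zeros] is the junk value [0]. *)
Definition first_one (x : nat -> bool) : nat :=
  if pselect (exists k, x k) is left h then ex_minn h else 0.

(** Written as a difference of nested cylinders, so that its measure follows by subtraction. *)
Definition level k : set (nat -> bool) := cylinder k zeros `\` cylinder k.+1 zeros.

Lemma levelP k x : level k x <-> x k /\ forall j, (j < k)%N -> ~~ x j.
Proof.
rewrite /level cylinderS; split=> [[zx]|[xk xj]].
  move=> H; split=> [|j /zx <-//].
  by apply/negPn/negP => /negPf xk; apply: H; split=> //=; rewrite xk.
by split=> [j /xj/negPf ->|[_]]; rewrite /= ?xk.
Qed.

Lemma first_one_unique k x : x k -> (forall j, (j < k)%N -> ~~ x j) ->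
  first_one x = k.
Proof.
move=> xk xj; rewrite /first_one; case: pselect => [h|[]]; last by exists k.
case: ex_minnP => m xm mmin; apply/eqP; rewrite eqn_leq mmin//= leqNgt.
by apply/negP => /xj; rewrite xm.
Qed.

Lemma first_one_level k x : level k x -> first_one x = k.
Proof. by move=> /levelP[xk xj]; exact: first_one_unique. Qed.

Lemma first_oneP x : x = zeros \/ level (first_one x) x.
Proof.
have [h|h] := pselect (exists k, x k); last first.
  left; apply/funext => k; apply/negbTE/negP => xk.
  by apply: h; exists k.
right; apply/levelP; case: (ex_minnP h) => m xm mmin.
have xj j : (j < m)%N -> ~~ x j.
  by move=> jm; apply/negP => /mmin; rewrite leqNgt jm.
by rewrite (first_one_unique xm xj).
Qed.

(** A sequence outside the cylinder around [zeros] has a 1 among its first [n] digits, and these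
    digits are shared by the whole cylinder. Hence u is constant there. *)
Lemma first_one_cylinder n z y : ~ cylinder n zeros z -> cylinder n z y ->
  first_one y = first_one z.
Proof.
move=> nz zy.
have [z0|/levelP[zk zj]] := first_oneP z; first by case: nz; rewrite z0.
have kn : (first_one z < n)%N.
  rewrite ltnNge; apply/negP => nk; apply: nz => j jn.
  by apply/esym/negbTE/zj/(leq_trans jn).
apply: first_one_unique; first by rewrite -zy.
by move=> j jk; rewrite -zy ?zj// (ltn_trans jk).
Qed.

Lemma cylinder_bigcup_level n :
  (cylinder n zeros : set (nat -> bool)) = [set zeros] `|` \bigcup_k level (n + k).
Proof.
apply/seteqP; split=> [x zx|x [->//|[k _ /levelP[_ xj]] j jn]].
  have [|xl] := first_oneP x; [by left|right].
  exists (first_one x - n)%N => //; rewrite subnKC// leqNgt; apply/negP => xn.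
  by have /levelP[] := xl; rewrite -zx.
by apply/esym/negbTE/xj/(leq_trans jn); rewrite leq_addr.
Qed.

Lemma trivIset_level n : trivIset setT (fun k => level (n + k)).
Proof.
move=> i j _ _ [x [/first_one_level xi /first_one_level]].
by rewrite xi => /eqP; rewrite eqn_add2l => /eqP.
Qed.

End first_one.

(** * Integrals of functions of the first 1 *)

Section integral_first_one.
Context {R : realType} (s : {posnum R}).
Local Notation X := (binseq s).
Local Notation mu := (@coin R s).
Implicit Types (x : X) (k n m : nat) (F T : nat -> R).

Lemma measurable_level k : measurable (level k : set (borel X)).
Proof. by apply: measurableD; exact: measurable_cylinder. Qed.

Lemma coin_level k : mu (level k) = (2^-1 ^+ k.+1)%:E.
Proof.
rewrite /level measureD; [|exact: measurable_cylinder..|]; last first.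
  by rewrite [ltLHS]coin_cylinder ltry.
rewrite (_ : _ `&` _ = cylinder k.+1 zeros); last first.
  by apply/setIidr => x; rewrite cylinderS => -[].
rewrite [X in (X - _)%E]coin_cylinder [X in (_ - X)%E]coin_cylinder.
by rewrite -EFinB exprS; congr EFin; lra.
Qed.

Lemma measurable_zeros : measurable [set (zeros : borel X)].
Proof.
rewrite (_ : [set _] = \bigcap_n (cylinder n zeros : set (borel X))).
  by apply: bigcapT_measurable => n; exact: measurable_cylinder.
apply/seteqP; split=> [x -> n _//|x xz]; apply/funext => k.
by rewrite -(xz k.+1 I k).
Qed.

(** The point lies in cylinders of measure 2^-n for every n. Hence the junk value of [first_one] at
    [zeros] does not affect integrals. *)
Lemma coin_zeros : mu [set zeros] = 0%E.
Proof.
apply/eqP; rewrite eq_le measure_ge0 andbT; apply/lee_addgt0Pr => e e0.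
have /cvgrPdist_lt /(_ _ e0) [n _ /(_ n (leqnn n))] :
    (2^-1 : R) ^+ n @[n --> \oo] --> 0.
  by apply: cvg_expr; rewrite gtr0_norm; lra.
rewrite /= sub0r normrN => /(le_lt_trans (ler_norm _))/ltW ne.
rewrite add0e (@le_trans _ _ (mu (cylinder n zeros)))//.
  apply: le_measure; rewrite ?inE; [exact: measurable_zeros|
    exact: measurable_cylinder|by move=> _ ->].
by rewrite coin_cylinder lee_fin.
Qed.

Lemma measurable_first_one F D :
  measurable_fun (D : set (borel X)) (fun x : borel X => F (first_one x)).
Proof.
apply: measurable_funTS => _ Y mY; rewrite setTI.
rewrite (_ : _ @^-1` _ = \bigcup_(k in [set k | Y (F k)])
    [set x : borel X | first_one x = k]).
  apply: bigcup_measurable => k _.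
  (* The fibre over 0 also contains [zeros], because of the junk value. *)
  have [->|k0] := eqVneq k 0.
    rewrite (_ : [set x | _] = [set zeros : borel X] `|` level 0).
      apply: measurableU; [exact: measurable_zeros|exact: measurable_level].
    apply/seteqP; split=> [x /= xk|x [->|]/=].
    - by have [|] := first_oneP x; [left|rewrite xk; right].
    - by rewrite /first_one; case: pselect => // -[].
    - exact: first_one_level.
  rewrite (_ : [set x | _] = level k); first exact: measurable_level.
  apply/seteqP; split=> [x /= xk|x]; last exact: first_one_level.
  have [x0|] := first_oneP x; last by rewrite xk.
  move: k0; rewrite -xk x0 /first_one; case: pselect => //=; first by case.
by apply/seteqP; split=> [x /= Yx|x [k /= Yk] ->//]; exists (first_one x).
Qed.

Lemma integral_first_one F n : (forall k, 0 <= F k) ->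
  (\int[mu]_(x in cylinder n zeros) (F (first_one x))%:E =
   \sum_(0 <= k <oo) (F (n + k) * 2^-1 ^+ (n + k).+1)%:E)%E.
Proof.
move=> F0; have mF D : measurable_fun (D : set (borel X))
    (fun x : borel X => (F (first_one x))%:E).
  by apply/measurable_EFinP; exact: measurable_first_one.
have ml k : measurable (level (n + k) : set (borel X)) by exact: measurable_level.
rewrite cylinder_bigcup_level ge0_integral_setU//=; first last.
- apply/disj_setPRL => x [k _ /levelP[xk _]] x0.
  by rewrite x0 in xk.
- by move=> x _; rewrite lee_fin.
- exact: bigcupT_measurable.
- exact: measurable_zeros.
rewrite [X in (X + _)%E]null_set_integral//; last 2 first.
- exact: measurable_zeros.
- exact: coin_zeros.
rewrite add0e.
rewrite ge0_integral_bigcup//; last 2 first.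
- by move=> x _; rewrite lee_fin.
- exact: trivIset_level.
apply: eq_eseriesr => k _.
rewrite (eq_integral (cst (F (n + k))%:E)).
  by rewrite integral_cst// [X in (_ * X)%E]coin_level.
by move=> x /set_mem/first_one_level ->.
Qed.

(** [T] acts as a discrete primitive: the partial sums telescope to at most T(n) - T(n+m), hence to
    at most T(n). *)
Lemma integral_first_one_le F T n : (forall k, 0 <= F k) ->
    (forall k, 0 <= T k) ->
    (forall k, (n <= k)%N -> F k * 2^-1 ^+ k.+1 <= T k - T k.+1) ->
  (\int[mu]_(x in cylinder n zeros) (F (first_one x))%:E <= (T n)%:E)%E.
Proof.
move=> F0 T0 FT; rewrite integral_first_one//; apply: lime_le.
  apply: is_cvg_nneseries => k _ _.
  by rewrite lee_fin mulr_ge0// exprn_ge0// invr_ge0.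
apply: nearW => m; rewrite sumEFin lee_fin.
apply: (@le_trans _ _ (\sum_(0 <= k < m) (- T (n + k.+1)%N - - T (n + k)%N))).
  by apply: ler_sum => k _; rewrite opprK [leRHS]addrC addnS FT// leq_addr.
rewrite (@telescope_sumr_eq _ 0 m (fun k => - T (n + k)%N))//= opprK addn0.
by rewrite gerDr oppr_le0.
Qed.

(** The same telescoping from below; the remainder T(n+m) must now tend to 0. *)
Lemma integral_first_one_ge F T n : (forall k, 0 <= F k) ->
    T k @[k --> \oo] --> 0 ->
    (forall k, (n <= k)%N -> T k - T k.+1 <= F k * 2^-1 ^+ k.+1) ->
  ((T n)%:E <= \int[mu]_(x in cylinder n zeros) (F (first_one x))%:E)%E.
Proof.
move=> F0 T0 FT; rewrite integral_first_one//.
apply/lee_addgt0Pr => e e0.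
have /cvgrPdist_lt /(_ _ e0) [m _ /(_ (n + m)%N (leq_addl _ _))] := T0.
rewrite /= sub0r normrN => /(le_lt_trans (ler_norm _))/ltW me.
apply: (@le_trans _ _
  (\sum_(0 <= k < m) (F (n + k)%N * 2^-1 ^+ (n + k).+1)%:E + e%:E)%E).
  rewrite sumEFin -EFinD lee_fin -lerBlDr.
  apply: (@le_trans _ _ (\sum_(0 <= k < m) (- T (n + k.+1)%N - - T (n + k)%N))).
    rewrite (@telescope_sumr_eq _ 0 m (fun k => - T (n + k)%N))//= opprK addn0.
    by rewrite addrC lerD2r lerN2.
  by apply: ler_sum => k _; rewrite opprK [leLHS]addrC addnS FT// leq_addr.
rewrite leeD2r//; apply: nneseries_lim_ge => k _ _.
by rewrite lee_fin mulr_ge0// exprn_ge0// invr_ge0.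
Qed.

End integral_first_one.

(** * Ahlfors regularity *)

Section coin_space.
Context {R : realType} (s : {posnum R}).
Local Notation X := (binseq s).
Local Notation mu := (@coin R s).
Local Notation l := (shrink s).

Lemma coin_metric_measure_space : metric_measure_space mu.
Proof.
split=> [|z r r0].
  exists (fun=> true), (fun=> false) => /(congr1 (fun f : nat -> bool => f 0)).
  by [].
have [n [-> _ _]] := ball_cylinderE z r0.
by rewrite [X in (_ < X < _)%E]coin_cylinder lte_fin ltry exprn_gt0.
Qed.

(** Raising l^(n+1) < r <= l^n to the power s gives 2^-(n+1) < r^s <= 2^-n, to be compared with the
    measure 2^-(n+1) of the ball. Depth 0 would force r > 1, above the diameter. *)
Lemma coin_ahlfors_regular : ahlfors_regular mu s%:num.
Proof.
exists 2 => [|z r r0]; first by rewrite ler1n.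
move=> /le_trans/(_ (diam_binseq_le1 s)); rewrite lee_fin => r1.
have [n [-> lr rl]] := ball_cylinderE z r0.
rewrite [X in (_ <= X <= _)%E]coin_cylinder !lee_fin -(shrinkX_powR s).
have s0 : 0 <= s%:num by [].
have l0 k : 0 <= l ^+ k by rewrite exprn_ge0// ltW// shrink_gt0.
case: n lr rl => [|n] lr; first by rewrite expr0 ltNge r1 in lr.
case=> // rl; apply/andP; split.
  have := ge0_ler_powR s0 _ _ rl; rewrite !nnegrE (ltW r0) l0 => /(_ isT isT).
  by rewrite !shrinkX_powR exprS; lra.
have := ge0_ler_powR s0 _ _ (ltW lr); rewrite !nnegrE (ltW r0) l0 => /(_ isT isT).
by have := powR_ge0 r s%:num; lra.
Qed.

End coin_space.

(** * The pair (u, g) of a decreasing sequence, and its Poincaré inequality *)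

Section profile.
Context {R : realType} (s : {posnum R}) (a : nat -> R).
Hypothesis a_ge0 : forall n, 0 <= a n.
Hypothesis a_decr : forall m n, (m <= n)%N -> a n <= a m.
Hypothesis a_cvg0 : a n `^ s%:num @[n --> \oo] --> 0.
Local Notation X := (binseq s).
Local Notation mu := (@coin R s).
Local Notation l := (shrink s).
Implicit Types (F : nat -> R) (n k : nat).

Let half_ge0 n : 0 <= 2^-1 ^+ n :> R.
Proof. by rewrite exprn_ge0. Qed.

(** The bound is c + d because N - n has mean 1 on the cylinder. *)
Lemma integral_first_one_affine F n (c d : R) : (forall k, 0 <= F k) ->
    0 <= c -> 0 <= d ->
    (forall k, (n <= k)%N -> F k <= c + d * (k - n)%:R) ->
  (\int[mu]_(x in cylinder n zeros) (F (first_one x))%:E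
     <= ((c + d) * 2^-1 ^+ n)%:E)%E.
Proof.
move=> F0 c0 d0 Fcd.
(* With this primitive T(k) - T(k+1) is exactly (c + d(k-n)) 2^-(k+1) for k >= n. *)
apply: (le_trans (@integral_first_one_le _ _ F
  (fun k => (c + d * (k - n).+1%:R) * 2^-1 ^+ k) _ _ _ _)) => //.
- by move=> k; rewrite mulr_ge0// addr_ge0// mulr_ge0.
- move=> k nk; have := ler_wpM2r (half_ge0 k.+1) (Fcd _ nk).
  by rewrite subSn// -[(k - n).+2]addn2 -[(k - n).+1]addn1 !natrD exprS; lra.
- by rewrite subnn mulr1.
Qed.

Lemma integral_first_one_cst F n (c : R) : (forall k, 0 <= F k) ->
    (forall k, (n <= k)%N -> c <= F k) ->
  ((c * 2^-1 ^+ n)%:E <=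
    \int[mu]_(x in cylinder n zeros) (F (first_one x))%:E)%E.
Proof.
move=> F0 cF; apply: (@integral_first_one_ge _ _ F (fun k => c * 2^-1 ^+ k)) => //.
- rewrite -[X in _ --> X](mulr0 c); apply: cvgMr.
  by apply: cvg_expr; rewrite gtr0_norm; lra.
- by move=> k nk; have := ler_wpM2r (half_ge0 k.+1) (cF _ nk); rewrite exprS; lra.
Qed.

Definition height n : R := \sum_(k < n) a k.

(** The value of g^s on level n. Weighted by the measure 2^-(n+1) of that level it becomes a
    telescoping difference. *)
Definition slope n : R := 2 ^+ n.+1 * (a n `^ s%:num - a n.+1 `^ s%:num).

Definition unbounded_fun (x : borel X) : R := height (first_one x).

Definition gradient (x : borel X) : R := slope (first_one x) `^ s%:num^-1.

Lemma height_ge0 n : 0 <= height n.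
Proof. by apply: sumr_ge0 => k _. Qed.

Lemma heightB n k : (n <= k)%N ->
  0 <= height k - height n <= a n * (k - n)%:R.
Proof.
move=> nk; rewrite /height -!(big_mkord xpredT) (@big_cat_nat _ _ _ n 0 k)//=.
rewrite addrAC subrr add0r.
rewrite sumr_ge0//= mulr_natr -sumr_const_nat.
by rewrite ler_sum_nat// => i /andP[ni _]; exact: a_decr.
Qed.

Lemma height_le k : height k <= a 0 * k%:R.
Proof.
have /andP[_] := heightB (leq0n k).
by rewrite [height 0]big_ord0 subr0 subn0.
Qed.

Lemma height_ge n : n%:R * a n <= height n.
Proof.
rewrite (_ : n%:R * a n = \sum_(k < n) a n).
  by apply: ler_sum => k _; apply: a_decr; exact: ltnW.
by rewrite sumr_const card_ord mulr_natl.
Qed.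

Lemma slope_ge0 n : 0 <= slope n.
Proof.
by rewrite mulr_ge0// subr_ge0 ge0_ler_powR ?nnegrE// a_decr.
Qed.

Lemma slopeE n : slope n * 2^-1 ^+ n.+1 = a n `^ s%:num - a n.+1 `^ s%:num.
Proof.
rewrite /slope mulrAC -exprMn (_ : 2 * 2^-1 = 1 :> R) ?expr1n ?mul1r//.
by rewrite divff.
Qed.

Lemma gradient_powR x : gradient x `^ s%:num = slope (first_one x).
Proof. by rewrite -powRrM mulVf// powRr1// slope_ge0. Qed.

Lemma integral_slope_ge n : ((a n `^ s%:num)%:E <=
  \int[mu]_(x in cylinder n zeros) (slope (first_one x))%:E)%E.
Proof.
apply: (@integral_first_one_ge _ _ slope (fun k => a k `^ s%:num)) => //.
- exact: slope_ge0.
- by move=> k _; rewrite slopeE.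
Qed.

Lemma integral_slope_le :
  (\int[mu]_x (slope (first_one x))%:E <= (a 0 `^ s%:num)%:E)%E.
Proof.
rewrite -(cylinder0 zeros).
apply: (@integral_first_one_le _ _ slope (fun k => a k `^ s%:num) 0) => //.
- exact: slope_ge0.
- by move=> k; exact: powR_ge0.
- by move=> k _; rewrite slopeE.
Qed.

Lemma unbounded_fun_integrable : mu.-integrable setT (EFin \o unbounded_fun).
Proof.
apply/integrableP; split.
  by apply/measurable_EFinP; exact: (measurable_first_one height).
apply: (@le_lt_trans _ _ (a 0 * 2^-1 ^+ 0)%:E); last exact: ltry.
rewrite (eq_integral (fun x : borel X => (height (first_one x))%:E)); last first.
  by move=> x _ /=; rewrite ger0_norm// height_ge0.
rewrite -[a 0]add0r -(cylinder0 zeros); apply: integral_first_one_affine => //.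
  exact: height_ge0.
by move=> k _; rewrite add0r subn0 height_le.
Qed.

Lemma slope_integrable :
  mu.-integrable setT (EFin \o (fun x => gradient x `^ s%:num)).
Proof.
have E : (fun x => gradient x `^ s%:num) = (fun x : borel X => slope (first_one x)).
  by apply/funext => x; exact: gradient_powR.
rewrite E; apply/integrableP; split.
  by apply/measurable_EFinP; exact: (measurable_first_one slope).
rewrite (eq_integral (fun x : borel X => (slope (first_one x))%:E)); last first.
  by move=> x _ /=; rewrite ger0_norm// slope_ge0.
by apply: (le_lt_trans integral_slope_le); exact: ltry.
Qed.

Lemma gradient_measurable : measurable_fun setT gradient.
Proof. exact: (measurable_first_one (fun n => slope n `^ s%:num^-1)). Qed.

Lemma gradient_Lfun : gradient \in Lfun mu s%:num%:E.
Proof.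
rewrite inE; apply/andP; split; rewrite inE/=; first exact: gradient_measurable.
rewrite /finite_norm unlock poweR_lty//.
case/integrableP : slope_integrable => _; apply: le_lt_trans.
rewrite le_eqVlt; apply/orP; left; apply/eqP; apply: eq_integral => x _ /=.
by rewrite !ger0_norm ?powR_ge0.
Qed.

(** [height] grows at most linearly, so its power is dominated by a geometric sequence. The ratio
    3/2 is below 2, hence summable against the weights 2^-k. *)
Lemma height_powR_le : exists2 C : R, 0 <= C &
  forall k, height k `^ s%:num <= C * (3 / 2) ^+ k.
Proof.
have ln0 : 0 < ln (3 / 2) :> R by rewrite ln_gt0//; lra.
(* With this [d] the [s]-th power of exp(dk) is (3/2)^k, while dk <= exp(dk). *)
pose d := ln (3 / 2) / s%:num.
have d0 : 0 < d by rewrite divr_gt0.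
exists ((a 0 / d) `^ s%:num) => [|k]; first exact: powR_ge0.
have ek : d * k%:R <= expR (d * k%:R).
  by apply: le_trans (expR_ge1Dx _); lra.
have -> : (3 / 2) ^+ k = expR (d * k%:R) `^ s%:num :> R.
  rewrite -expRM mulrAC /d mulfVK// -[in LHS](@lnK _ (3 / 2)) ?posrE; last lra.
  by rewrite -expRM_natr.
have ad : 0 <= a 0 / d by rewrite divr_ge0// ltW.
have ee := expR_ge0 (d * k%:R).
rewrite -powRM// ge0_ler_powR ?nnegrE ?height_ge0//; first exact: mulr_ge0.
by rewrite (le_trans (height_le k))// mulrAC ler_pdivlMr// -mulrA ler_wpM2l// mulrC.
Qed.

Lemma unbounded_fun_Lfun : unbounded_fun \in Lfun mu s%:num%:E.
Proof.
rewrite inE; apply/andP; split; rewrite inE/=.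
  exact: (measurable_first_one height).
rewrite /finite_norm unlock poweR_lty//.
rewrite (eq_integral (fun x : borel X => (height (first_one x) `^ s%:num)%:E)); last first.
  by move=> x _ /=; rewrite ger0_norm ?height_ge0.
have [C C0 hC] := height_powR_le.
apply: (@le_lt_trans _ _ (2 * C)%:E); last exact: ltry.
rewrite -(cylinder0 zeros).
(* The decrements of this primitive are exactly C (3/2)^k 2^-(k+1). *)
apply: (le_trans (@integral_first_one_le _ _ (fun k => height k `^ s%:num)
  (fun k => 2 * C * (3 / 4) ^+ k) 0 _ _ _)) => //.
- by move=> k; exact: powR_ge0.
- by move=> k; rewrite mulr_ge0// ?exprn_ge0// mulr_ge0.
- move=> k _; have := ler_wpM2r (half_ge0 k.+1) (hC k).
  rewrite -[C * _ * _]mulrA [2^-1 ^+ k.+1]exprS.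
  have -> : (3 / 2) ^+ k * (2^-1 * 2^-1 ^+ k) = 2^-1 * (3 / 4) ^+ k :> R.
    rewrite mulrCA -exprMn; congr (_ * _ ^+ _); lra.
  by rewrite !exprS; lra.
- by rewrite expr0 mulr1.
Qed.

(** On the cylinder u lies between [height n] and [height n + a n * (N - n)], and N - n has mean
    1. *)
Lemma unbounded_fun_mean n :
  height n <= mean mu (cylinder n zeros) unbounded_fun <= height n + a n.
Proof.
rewrite /mean /average.
set I := (\int[_]_(x in _) _)%E.
have I1 : ((height n * 2^-1 ^+ n)%:E <= I)%E.
  apply: (integral_first_one_cst (F := height)); first exact: height_ge0.
  by move=> k /heightB/andP[]; rewrite subr_ge0.
have I2 : (I <= ((height n + a n) * 2^-1 ^+ n)%:E)%E.
  apply: (integral_first_one_affine (F := height)) => //.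
  - exact: height_ge0.
  - exact: height_ge0.
  - by move=> k /heightB/andP[_]; rewrite lerBlDl.
rewrite [X in (X^-1)%E]coin_cylinder.
case: I I1 I2 => [I|//|//]; rewrite !lee_fin inver gt_eqF ?exprn_gt0// -EFinM/=.
rewrite ler_pdivlMl ?exprn_gt0// ler_pdivrMl ?exprn_gt0//.
by rewrite !(mulrC (2^-1 ^+ n)) => -> ->.
Qed.

(** By the bounds on the mean, |u - m| is at most [a n + a n * (N - n)], whose average is
    [2 * a n]. *)
Lemma average_oscillation_le n (B := cylinder n zeros) :
  (average mu B (fun x => `|unbounded_fun x - mean mu B unbounded_fun|%:E)
    <= (2 * a n)%:E)%E.
Proof.
have := unbounded_fun_mean n; rewrite -/B; set m := mean _ _ _ => /andP[m1 m2].
rewrite /average [X in (X^-1)%E]coin_cylinder inver gt_eqF ?exprn_gt0//.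
have : (\int[mu]_(x in B) `|unbounded_fun x - m|%:E <=
    ((a n + a n) * 2^-1 ^+ n)%:E)%E.
  apply: (integral_first_one_affine (F := fun k => `|height k - m|)) => //.
  move=> k /heightB/andP[h1 h2]; rewrite ler_norml; apply/andP; split.
    by have := a_ge0 n; lra.
  by lra.
move=> /(lee_wpmul2l (_ : (0 <= ((2^-1 ^+ n)^-1)%:E)%E))/le_trans; apply.
  by rewrite lee_fin invr_ge0.
by rewrite -EFinM lee_fin mulrC mulfK ?gt_eqF ?exprn_gt0//; lra.
Qed.

Lemma integrable_locally_integrable (f : borel X -> R) :
  mu.-integrable setT (EFin \o f) -> Defs.locally_integrable mu f.
Proof.
move=> fi; split=> [|z]; first by apply/measurable_EFinP; case/integrableP : fi.
exists 1 => //; apply: integrableS fi => //.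
have [n [-> _ _]] := ball_cylinderE z (@ltr01 R).
exact: measurable_cylinder.
Qed.

(** The average of g^s is at least 2^n a_n^s, and the s-th root of 2^n is [l ^- n], which will
    cancel the diameter. *)
Lemma average_gradient_ge n : ((l ^- n * a n)%:E <=
  average mu (cylinder n zeros) (fun x => (gradient x `^ s%:num)%:E)
    `^ s%:num^-1)%E.
Proof.
have -> : l ^- n * a n = (2 ^+ n * a n `^ s%:num) `^ s%:num^-1.
  rewrite powRM ?exprn_ge0 ?powR_ge0// -powRrM mulfV// powRr1//.
  have l0 : 0 <= l ^+ n by rewrite exprn_ge0// ltW// shrink_gt0.
  rewrite -[2 ^+ n]invrK -(exprVn 2 n) -(shrinkX_powR s) -!powR_inv1 ?powR_ge0//.
  by rewrite -!powRrM mulN1r mulrN [s%:num `^ _]powR_inv1// mulfV.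
rewrite -poweR_EFin; apply: gt0_ler_poweR => //.
- by rewrite in_itv/= leey andbT lee_fin mulr_ge0 ?powR_ge0 ?exprn_ge0.
- rewrite in_itv/= leey andbT /average [X in (X^-1)%E]coin_cylinder inver.
  rewrite gt_eqF ?exprn_gt0// mule_ge0// ?lee_fin ?invr_ge0//.
  by rewrite integral_ge0// => x _; rewrite lee_fin powR_ge0.
rewrite /average [X in (X^-1)%E]coin_cylinder inver gt_eqF ?exprn_gt0//.
under eq_integral do rewrite gradient_powR.
rewrite EFinM exprVn invrK lee_wpmul2l ?lee_fin ?exprn_ge0//.
exact: integral_slope_ge.
Qed.

Lemma average_oscillation_away n z : ~ cylinder n zeros z ->
  average mu (cylinder n z) (fun x =>
    `|unbounded_fun x - mean mu (cylinder n z) unbounded_fun|%:E) = 0%E.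
Proof.
move=> nz; set B := cylinder n z; pose c := height (first_one z).
have mB : measurable (B : set (borel X)) by exact: measurable_cylinder.
have uc x : x \in B -> unbounded_fun x = c.
  by move=> /set_mem /(first_one_cylinder nz) E; rewrite /unbounded_fun E.
have -> : mean mu B unbounded_fun = c.
  rewrite /mean /average (eq_integral (cst c%:E)) => [|x xB]; last first.
    by rewrite /= uc.
  rewrite integral_cst// [X in (X^-1)%E]coin_cylinder.
  rewrite [X in (_ * (_ * X))%E]coin_cylinder.
  rewrite inver gt_eqF ?exprn_gt0// -!EFinM/=.
  by rewrite mulrC mulfK// gt_eqF ?exprn_gt0.
rewrite /average (eq_integral (cst 0%E)) ?integral0 ?mule0// => x xB.
by rewrite uc// subrr normr0.
Qed.

Lemma unbounded_fun_poincare : poincare_inequality mu s%:num unbounded_fun gradient.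
Proof.
split.
- exact/integrable_locally_integrable/unbounded_fun_integrable.
- by move=> x; exact: powR_ge0.
- exact: gradient_measurable.
- exact/integrable_locally_integrable/slope_integrable.
exists 1, 2; split=> // z r r0; rewrite mul1r.
have [n [-> _ _]] := ball_cylinderE z r0.
have diam0 := le_trans (_ : (0 <= (l ^+ n)%:E)%E) (diam_cylinder_ge n z).
have l0 : 0 < l ^+ n by rewrite exprn_gt0// shrink_gt0.
have [nz|nz] := pselect (cylinder n zeros z); last first.
  rewrite average_oscillation_away// mule_ge0 ?poweR_ge0// mule_ge0//.
  by rewrite diam0// lee_fin ltW.
rewrite -(cylinder_eq nz); apply: (le_trans (average_oscillation_le n)).
rewrite -muleA EFinM lee_wpmul2l//.
(* Split a_n as l^n times l^-n a_n: the first factor is bounded by the diameter, the second by the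
   gradient term. *)
rewrite -[X in (X%:E <= _)%E](mulVKf (lt0r_neq0 l0)) EFinM lee_pmul//.
- by rewrite lee_fin ltW.
- by rewrite lee_fin mulr_ge0// invr_ge0 ltW.
- exact: diam_cylinder_ge.
- exact: average_gradient_ge.
Qed.

End profile.

(** * Divergence of exponential integrals *)

Lemma integral_expR_first_one_oo (R : realType) (s : {posnum R}) (f : nat -> R) :
    (forall M : R, exists n : nat, n.+1%:R + M <= f n) ->
  (\int[@coin R s]_x (expR (f (first_one x)))%:E = +oo)%E.
Proof.
move=> fM; apply/eqyP => M M0; have [n nM] := fM M.
have mF D : measurable_fun (D : set (borel (binseq s)))
    (fun x : borel (binseq s) => (expR (f (first_one x)))%:E).
  apply/measurable_EFinP; exact: (measurable_first_one (expR \o f)).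
(* A single level suffices: it contributes exp(f(n)) 2^-(n+1). *)
apply: (@le_trans _ _
  (\int[@coin R s]_(x in level n) (expR (f (first_one x)))%:E)%E); last first.
  by apply: ge0_subset_integral => //; exact: measurable_level.
rewrite (eq_integral (cst (expR (f n))%:E)); last first.
  by move=> x /set_mem/first_one_level ->.
rewrite integral_cst; last exact: measurable_level.
rewrite [X in (_ * X)%E]coin_level -EFinM lee_fin -ler_pdivrMr ?exprn_gt0//.
(* Since e >= 2, the factor exp(n+1) makes up for 2^-(n+1), and exp(M) >= M remains. *)
apply: (@le_trans _ _ (expR (n.+1%:R + M))); last by rewrite ler_expR.
rewrite expRD mulrC exprVn invrK ler_pM ?exprn_ge0 ?(ltW M0)//.
  rewrite -[n.+1%:R]mulr1 expRM_natl lerXn2r ?nnegrE ?expR_ge0//.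
  by have := @expR_ge1Dx R 1; lra.
by have := @expR_ge1Dx R M; lra.
Qed.

(** * The sequence 1/ln(n+2) and the growth of its partial sums *)

Section inverse_log.
Context {R : realType}.
Implicit Types (n : nat).

Definition inv_log n : R := (ln n.+2%:R)^-1.

Lemma inv_log_gt0 n : 0 < inv_log n.
Proof. by rewrite invr_gt0 ln_gt0// ltr1n. Qed.

Lemma inv_log_decr m n : (m <= n)%N -> inv_log n <= inv_log m.
Proof.
move=> mn; rewrite /inv_log lef_pV2 ?posrE ?ln_gt0 ?ltr1n//.
by rewrite ler_ln ?posrE ?ltr0n// ler_nat !ltnS.
Qed.

Lemma inv_log_cvg0 (s : {posnum R}) : inv_log n `^ s%:num @[n --> \oo] --> 0.
Proof.
apply/cvgrPdist_le => e e0; near=> n.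
rewrite sub0r normrN ger0_norm ?powR_ge0//.
have e0' : 0 < e `^ s%:num^-1 by rewrite powR_gt0.
have -> : e = (e `^ s%:num^-1) `^ s%:num by rewrite -powRrM mulVf// powRr1// ltW.
rewrite ge0_ler_powR ?nnegrE ?(ltW (inv_log_gt0 n)) ?(ltW e0')//.
rewrite /inv_log -[leRHS]invrK lef_pV2 ?posrE ?ln_gt0 ?ltr1n ?invr_gt0//.
rewrite -[leLHS]expRK ler_ln ?posrE ?expR_gt0 ?ltr0n//.
rewrite (@le_trans _ _ n%:R)//; last by rewrite ler_nat; lia.
by near: n; exact: nbhs_infty_ger.
Unshelve. all: by end_near. Qed.

(** Equivalent to ln x <= x^d / d with x = n + 2, which is ln y <= y - 1 at y = x^d. *)
Lemma inv_log_powR_ge (d : R) n : 0 < d -> d * n.+2%:R `^ (- d) <= inv_log n.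
Proof.
move=> d0; have x0 : 0 < n.+2%:R :> R by rewrite ltr0n.
rewrite powRN -[d]invrK -invfM invrK lef_pV2 ?posrE ?ln_gt0 ?ltr1n//; last first.
  by rewrite mulr_gt0 ?invr_gt0// powR_gt0.
rewrite ler_pdivlMl// -ln_powR.
have := @le_ln1Dx R (n.+2%:R `^ d - 1); rewrite addrCA subrr addr0.
by move/(_ _)/le_trans; apply; [have := powR_gt0 d x0; lra|lra].
Qed.

Lemma powR_root_le (d x y : R) : 0 < d -> 0 <= y -> y `^ d^-1 <= x -> y <= x `^ d.
Proof.
move=> d0 y0 yx; have -> : y = (y `^ d^-1) `^ d.
  by rewrite -powRrM mulVf ?powRr1// gt_eqF.
by rewrite ge0_ler_powR ?nnegrE ?powR_ge0 ?(ltW d0)// (le_trans _ yx)// powR_ge0.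
Qed.

(* With x = n + 2, the height at n is at least a constant times x ^ (1 - d) for
   every d > 0, whose q-th power beats any linear function of n when d is small. *)
Lemma height_inv_log_growth (q c m M : R) : 1 < q -> 0 < c ->
  exists n, n.+1%:R + M <= c * `|height inv_log n - m| `^ q.
Proof.
move=> q1 c0.
(* Here 1/q < t < 1, so (x^t)^q = x^(1+e) with e > 0. Since 1 - d = t + d, the bound x^(1-d) leaves
   a spare factor x^d to absorb constants. *)
pose t := 2 / (q + 1); pose d := (1 - t) / 2; pose e := t * q - 1.
have t0 : 0 < t by rewrite divr_gt0; lra.
have t1 : t < 1 by rewrite ltr_pdivrMr; lra.
have d0 : 0 < d by rewrite /d; lra.
have e0 : 0 < e.
  by rewrite subr_gt0 /t mulrAC ltr_pdivlMr; lra.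
(* The first threshold lets x^d absorb the shift by [m], the second lets c x^e exceed 1 + |M|. *)
have [n0 n0P] : exists n : nat, Num.max ((2 * (1 + `|m|) / d) `^ d^-1)
    (((1 + `|M|) / c) `^ e^-1) < n%:R.
  by exists (Num.bound (Num.max ((2 * (1 + `|m|) / d) `^ d^-1)
    (((1 + `|M|) / c) `^ e^-1))); rewrite archi_boundP// le_max powR_ge0.
move: n0P; rewrite gt_max => /andP[n0d n0e].
(* The shift ensures n >= 2, hence x = n + 2 <= 2n. *)
pose n := n0.+2; exists n; set x : R := n.+2%:R.
have x4 : 4 <= x by rewrite /x ler_nat.
have n0x : n0%:R <= x by rewrite /x ler_nat; lia.
have xd : 2 * (1 + `|m|) / d <= x `^ d.
  apply: powR_root_le => //;
    first by rewrite divr_ge0 ?(ltW d0)// mulr_ge0// addr_ge0.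
  exact: le_trans (ltW n0d) n0x.
have xe : (1 + `|M|) / c <= x `^ e.
  apply: powR_root_le => //; first by rewrite divr_ge0 ?(ltW c0)// addr_ge0.
  exact: le_trans (ltW n0e) n0x.
have nx : x / 2 <= n%:R.
  have -> : x = n%:R + 2 by rewrite /x -addn2 natrD.
  have : 2 <= n%:R :> R by rewrite ler_nat.
  by lra.
have xt : 1 <= x `^ t by rewrite -[leLHS](powRr0 x) ler_powR; lra.
have hn : x `^ t <= height inv_log n - m.
  rewrite lerBrDr (le_trans _ (height_ge inv_log_decr n))//.
  have dx0 : 0 <= d * x `^ (- d) by rewrite mulr_ge0 ?powR_ge0 ?(ltW d0).
  apply: le_trans (ler_pM _ dx0 nx (inv_log_powR_ge n d0)); last lra.
  have -> : x / 2 * (d * x `^ (- d)) = x `^ t * (d / 2 * x `^ d).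
    have -> : x / 2 * (d * x `^ (- d)) = d / 2 * (x `^ 1 * x `^ (- d)).
      by rewrite powRr1; [ring|lra].
    rewrite [RHS]mulrCA -!powRD ?(gt_eqF (lt_le_trans _ x4)) ?implybT//.
    by congr (_ * x `^ _); rewrite /d; lra.
  have xdm : 1 + `|m| <= d / 2 * x `^ d.
    by move: xd; rewrite ler_pdivrMr//; lra.
  (* From x^t (1 + |m|), the part x^t |m| covers [m] because x^t >= 1, and x^t is left. *)
  have := ler_wpM2l (powR_ge0 x t) xdm; apply: le_trans.
  by rewrite mulrDr mulr1 lerD2l (le_trans (ler_norm m))// ler_peMl.
have hq : x * x `^ e <= `|height inv_log n - m| `^ q.
  have -> : x * x `^ e = (x `^ t) `^ q.
    rewrite -powRrM -{1}[x]powRr1; last lra.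
    rewrite -powRD ?(gt_eqF (lt_le_trans _ x4)) ?implybT//.
    by congr (x `^ _); rewrite /e; lra.
  rewrite ge0_ler_powR ?nnegrE ?powR_ge0//; first lra.
  exact: le_trans hn (ler_norm _).
have : x * (1 + `|M|) <= c * (x * x `^ e).
  by rewrite mulrCA ler_wpM2l; [|lra|move: xe; rewrite ler_pdivrMr// mulrC].
have : M <= x * `|M|.
  by rewrite (le_trans (ler_norm M))// ler_peMl//; lra.
have : n.+1%:R <= x by rewrite /x ler_nat.
by have := ler_wpM2l (ltW c0) hq; lra.
Qed.

End inverse_log.

(** * The example for a given exponent s *)

Theorem theorem1p10 (R : realType) (s : R) (hs : 1 < s) :
  exists (X : pmetricType R) (mu : {measure set (borel X) -> \bar R}),
    [/\ metric_measure_space mu,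
        ahlfors_regular mu s,
        compact [set: X] &
        exists u g : borel X -> R,
          [/\ u \in Lfun mu s%:E,
              g \in Lfun mu s%:E,
              poincare_inequality mu s u g &
              forall q c : R, 1 < q -> 0 < c ->
                (\int[mu]_x (expR (c * `|u x - mean mu [set: X] u| `^ q))%:E
                 = +oo)%E]].
Proof.
pose p := PosNum (lt_trans ltr01 hs).
have a0 n : 0 <= @inv_log R n by rewrite ltW// inv_log_gt0.
have ad := @inv_log_decr R.
have al := @inv_log_cvg0 R p.
exists (binseq p), (@coin R p); split.
- exact: coin_metric_measure_space.
- exact: (@coin_ahlfors_regular R p).
- exact: compact_binseq.
exists (@unbounded_fun R p inv_log), (@gradient R p inv_log); split.
- exact: (@unbounded_fun_Lfun R p).
- exact: (@gradient_Lfun R p).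
- exact: (@unbounded_fun_poincare R p).
(* The growth estimate holds for every real [m], so the mean of u need not be computed. *)
- move=> q c q1 c0; set m := mean _ _ _.
  apply: (@integral_expR_first_one_oo R p
    (fun n => c * `|height inv_log n - m| `^ q)) => M.
  exact: height_inv_log_growth.
Qed.
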